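(* Let $M$ be a closed Riemannian manifold, let $T$ be a $C^1$ $\mathbb{Z}^k$-action on $M$ with generators $f_1,\dots,f_k$, let $\mu$ be a $T$-invariant Borel probability measure on $M$, let $m$ be a probability measure on $\mathcal{G}=\{f_1,\dots,f_k\}$, and let $\varphi$ be the induced random $\mathbb{Z}^k$-action over $(\Omega,\mathcal{A},\mathbf{P}_m,\sigma)$. Then for $\mathbf{P}_m\times\mu$-a.e. $(\omega,x)$ and each $1\le j\le s(x)$, $$\lambda_j(\omega,x)=\sum_{i=1}^k m_i\,\lambda_{i,j}(x),$$ where $m_i=m(\{f_i\})$, $\lambda_j(\omega,x)$ is the $j$-th Lyapunov exponent of $\varphi$ at $(\omega,x)$, and $\lambda_{i,j}(x)$ are the Lyapunov exponents of the generators.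
   Context: $M$ is a $d$-dimensional closed (compact, boundaryless) Riemannian manifold. A $C^r$ $\mathbb{Z}^k$-action is a homomorphism $T$ from $\mathbb{Z}^k$ to the group of $C^r$ diffeomorphisms of $M$; its generators are the commuting diffeomorphisms $f_i=T^{\vec e_i}$, $1\le i\le k$, with $\vec e_i$ the standard $i$-th generator of $\mathbb{Z}^k$. The generators are labelled by $i$, so that $\sum_i m_i=1$. A measure $\mu$ is $T$-invariant if it is $f_i$-invariant for each $i$. Spectrum of $T$ (known fact): there is a measurable set $\Gamma\subset M$ with $f_i(\Gamma)=\Gamma$ for each $i$ and $\mu(\Gamma)=1$, such that for every $x\in\Gamma$ there are a decomposition $T_xM=\bigoplus_{j=1}^{s(x)}E_j(x)$ with $\dim E_j(x)=d_j(x)$ ($s$ and $d_j$ measurable) and numbers $\lambda_{i,j}(x)$ ($1\le i\le k$, $1\le j\le s(x)$) satisfying: $Df_i(x)E_j(x)=E_j(f_i(x))$ and $\lambda_{i,j}(f_{i'}(x))=\lambda_{i,j}(x)$ for $1\le i,i'\le k$; and for all $t_1,\dots,t_k\in\mathbb{Z}$, $1\le j\le s(x)$ and $0\ne u\in E_j(x)$, $\lim_{n\to\pm\infty}\frac1n\log\|D(f_1^{t_1}\circ\cdots\circ f_k^{t_k})^n(x)u\|=\sum_{r=1}^k t_r\lambda_{r,j}(x)$. Random $\mathbb{Z}^k$-action: $\Omega=\mathcal{G}^{\mathbb{Z}}$ with product topology and product Borel $\sigma$-algebra $\mathcal{A}$; $\sigma$ is the left shift, $(\sigma\omega)_n=\omega_{n+1}$;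 $\mathbf{P}_m=m^{\mathbb{Z}}$. For $\omega=(\omega_n)\in\Omega$ put $\varphi_\omega=\omega_0$ and $\varphi_\omega^n=\varphi_{\sigma^{n-1}\omega}\circ\cdots\circ\varphi_{\sigma\omega}\circ\varphi_\omega$ for $n>0$, $\varphi_\omega^0=\mathrm{id}$, $\varphi_\omega^n=\varphi_{\sigma^n\omega}^{-1}\circ\cdots\circ\varphi_{\sigma^{-1}\omega}^{-1}$ for $n<0$. The system generated by the random compositions $\varphi_\omega^n$ is the random $\mathbb{Z}^k$-action $\varphi$ over $(\Omega,\mathcal{A},\mathbf{P}_m,\sigma)$. The associated skew product is $\Phi(\omega,x)=(\sigma\omega,\varphi_\omega(x))$. Random Lyapunov exponents (existence follows from the Multiplicative Ergodic Theorem for random dynamical systems): there is a Borel set $\Lambda\subset\Omega\times\Gamma$ with $(\mathbf{P}_m\times\mu)(\Lambda)=1$ and $\Phi(\Lambda)\subset\Lambda$ such that for $(\omega,x)\in\Lambda$, with the same decomposition $T_xM=\bigoplus_{j=1}^{s(x)}E_j(x)$, there are numbers $\lambda_j(\omega,x)$, $1\le j\le s(x)$, with $\lim_{n\to\pm\infty}\frac1n\log\|D\varphi_\omega^n(x)u\|=\lambda_j(\omega,x)$ for all $0\ne u\in E_j(x)$. The number $\lambda_j(\omega,x)$ is the $j$-th Lyapunov exponent of $\varphi$ at $(\omega,x)$. *)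

(* Defs.v *)
From HB Require Import structures.
From mathcomp Require Import all_boot all_order all_algebra.
From mathcomp Require Import all_classical all_reals all_analysis.
Set Implicit Arguments.
Unset Strict Implicit.
Unset Printing Implicit Defensive.
Import Order.TTheory GRing.Theory Num.Theory.
Import numFieldNormedType.Exports.
Local Open Scope classical_set_scope.
Local Open Scope ring_scope.

(* [f] is of class C^n on the open set [U]; on a finite-dimensional [V],
   continuity of [x |-> 'd f x] is the same as continuity of
   [x |-> 'd f x v] for every [v]. *)
Fixpoint class_C (R : realType) (V W : normedModType R) (n : nat) (U : set V)
    (f : V -> W) : Prop :=
  if n is p.+1 then
    (forall x, U x -> differentiable f x) /\
    (forall v, class_C p U (fun x => 'd f x v))
  else forall x, U x -> {for x, continuous f}.

Record chart (R : realType) (M : topologicalType) (d : nat) := Chart {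
  chart_dom : set M ;
  coords : M -> 'rV[R]_d ;
  param : 'rV[R]_d -> M ;
  chart_dom_open : open chart_dom ;
  chart_codom_open : open (coords @` chart_dom) ;
  coordsK : forall x, chart_dom x -> param (coords x) = x ;
  coords_continuous : forall x, chart_dom x -> {for x, continuous coords} ;
  param_continuous : forall y, (coords @` chart_dom) y -> {for y, continuous param} }.

(* [chart_at] selects a chart around each point; the tangent space at [x] is
   identified with 'rV_d through the coordinates of [chart_at x]. *)
Record closed_manifold (R : realType) (M : topologicalType) (d : nat) :=
  ClosedManifold {
  manifold_compact : compact [set: M] ;
  manifold_hausdorff : hausdorff_space M ;
  manifold_second_countable : @second_countable M ;
  atlas : set (chart R M d) ;
  chart_at : M -> chart R M d ;
  chart_at_atlas : forall x, atlas (chart_at x) ;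
  chart_at_dom : forall x, chart_dom (chart_at x) x ;
  transition_smooth : forall c c', atlas c -> atlas c' -> forall n,
    class_C n (coords c @` (chart_dom c `&` chart_dom c')) (coords c' \o param c) }.

Section Manifold.
Context (R : realType) (M : topologicalType) (d : nat).
Variable X : closed_manifold R M d.

Definition class_C_map (r : nat) (f : M -> M) : Prop :=
  continuous f /\
  forall c c', atlas X c -> atlas X c' ->
    class_C r (coords c @` (chart_dom c `&` f @^-1` chart_dom c'))
      (coords c' \o f \o param c).

(* D f (x) : T_x M -> T_(f x) M *)
Definition tangent_map (f : M -> M) (x : M) : {linear 'rV[R]_d -> 'rV[R]_d} :=
  'd (coords (chart_at X (f x)) \o f \o param (chart_at X x))
     (coords (chart_at X x) x).

(* The vector of T_x M whose components in the chart [c] are [v]. *)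
Definition from_chart (c : chart R M d) (x : M) (v : 'rV[R]_d) : 'rV[R]_d :=
  'd (coords (chart_at X x) \o param c) (coords c x) v.

Definition bilinear_of (A : 'M[R]_d) (u v : 'rV[R]_d) : R :=
  (u *m A *m v^T) 0 0.

(* [gram x] is the Gram matrix of the inner product of T_x M in the
   coordinates of [chart_at x]; since [chart_at] need not vary continuously,
   smoothness is required after passing to any fixed chart. *)
Record riemannian_metric := RiemannianMetric {
  gram : M -> 'M[R]_d ;
  gram_sym : forall x, (gram x)^T = gram x ;
  gram_pos : forall x u, u != 0 -> 0 < bilinear_of (gram x) u u ;
  gram_smooth : forall c, atlas X c -> forall (v w : 'rV[R]_d) n,
    class_C n (coords c @` chart_dom c) (fun y =>
      bilinear_of (gram (param c y))
        (from_chart c (param c y) v) (from_chart c (param c y) w) : R^o) }.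

Definition tangent_norm (g : riemannian_metric) (x : M) (u : 'rV[R]_d) : R :=
  Num.sqrt (bilinear_of (gram g x) u u).

(* The values at negative vectors make each [zk_map a] a diffeomorphism. *)
Record C1_action (k : nat) := C1Action {
  zk_map :> 'rV[int]_k -> M -> M ;
  zk_map0 : forall x, zk_map 0 x = x ;
  zk_mapD : forall a b x, zk_map (a + b) x = zk_map a (zk_map b x) ;
  zk_map_C1 : forall a, class_C_map 1 (zk_map a) }.

Definition generator (k : nat) (T : C1_action k) (i : 'I_k) : M -> M :=
  T (delta_mx 0 i).

Definition generator_inv (k : nat) (T : C1_action k) (i : 'I_k) : M -> M :=
  T (- delta_mx 0 i).

End Manifold.

(* a_n -> l both as n -> +oo and as n -> -oo *)
Definition cvg_two_sided (R : realType) (a : int -> R) (l : R) : Prop :=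
  (fun n : nat => a n%:Z) @ \oo --> l /\
  (fun n : nat => a (- n%:Z)) @ \oo --> l.

Definition borel (M : ptopologicalType) := g_sigma_algebraType (@open M).

Definition action_invariant (R : realType) (M : ptopologicalType) (d k : nat)
    (X : closed_manifold R M d) (T : C1_action X k)
    (mu : probability (borel M) R) : Prop :=
  forall (i : 'I_k) (A : set (borel M)), measurable A ->
    mu (generator T i @^-1` A) = mu A.

(* The labels of the generators of an action of Z^(k+1), with the discrete
   sigma-algebra; labels are kept distinct even if the maps are not. *)
Definition labels (k : nat) : Type := 'I_k.+1.
HB.instance Definition _ k := Choice.copy (labels k) 'I_k.+1.
HB.instance Definition _ k := isPointed.Build (labels k) ord0.
HB.instance Definition _ k := @isMeasurable.Build default_measure_display
  (labels k) discrete_measurable discrete_measurable0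
  discrete_measurableC discrete_measurableU.

(* The sets {w | w_n \in A} generate the product sigma-algebra, which is the
   Borel sigma-algebra of the product topology as the alphabet is finite. *)
Definition one_cylinders (k : nat) : set (set (int -> labels k)) :=
  [set C | exists (n : int) (A : set (labels k)), C = [set w | A (w n)]].

Definition bisequences (k : nat) := g_sigma_algebraType (@one_cylinders k).

(* P = m^Z; this determines [P] by uniqueness on the pi-system of cylinders. *)
Definition is_power_measure (R : realType) (k : nat)
    (m : probability (labels k) R) (P : probability (bisequences k) R) : Prop :=
  forall (J : seq int) (A : int -> set (labels k)), uniq J ->
    P [set w | forall n, n \in J -> A n (w n)] = (\prod_(n <- J) m (A n))%E.

Section RandomAction.
Context (R : realType) (M : ptopologicalType) (d k : nat).
Variables (X : closed_manifold R M d) (T : C1_action X k.+1).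

Definition shift_seq (n : int) (w : bisequences k) : bisequences k :=
  fun p => w (p + n).

Definition phi (w : bisequences k) : M -> M := generator T (w 0).

Definition phi_inv (w : bisequences k) : M -> M := generator_inv T (w 0).

Fixpoint forward (n : nat) (w : bisequences k) : M -> M :=
  if n is p.+1 then phi (shift_seq p%:Z w) \o forward p w else idfun.

Fixpoint backward (n : nat) (w : bisequences k) : M -> M :=
  if n is p.+1 then phi_inv (shift_seq (- p.+1%:Z) w) \o backward p w else idfun.

Definition phi_iter (n : int) (w : bisequences k) : M -> M :=
  match n with Posz p => forward p w | Negz p => backward p.+1 w end.

Definition skew_product (z : bisequences k * borel M) : bisequences k * borel M :=
  (shift_seq 1 z.1, phi z.1 z.2).

End RandomAction.

(* The subspaces E_0(x), ..., E_(s(x)-1)(x) are indexed from 0.  They are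
   nonzero: the exponent attached to the zero subspace would be arbitrary. *)
Record lyapunov_spectrum (R : realType) (M : ptopologicalType) (d k : nat)
    (X : closed_manifold R M d) (g : riemannian_metric X) (T : C1_action X k)
    (mu : probability (borel M) R) := LyapunovSpectrum {
  regular_set : set (borel M) ;
  nblocks : borel M -> nat ;
  oseledets : M -> nat -> {vspace 'rV[R]_d} ;
  exponent : 'I_k -> nat -> M -> R ;
  regular_measurable : measurable regular_set ;
  regular_full : mu regular_set = 1%E ;
  regular_invariant : forall i, generator T i @` regular_set = regular_set ;
  nblocks_measurable : measurable_fun regular_set nblocks ;
  block_dim_measurable : forall j,
    measurable_fun (regular_set `&` [set x | (j < nblocks x)%N])
      (fun x : borel M => \dim (oseledets x j)) ;
  block_neq0 : forall x j, regular_set x -> (j < nblocks x)%N ->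
    oseledets x j != 0%VS ;
  block_full : forall x, regular_set x ->
    (\sum_(j < nblocks x) oseledets x j)%VS = fullv ;
  block_direct : forall x, regular_set x ->
    directv (\sum_(j < nblocks x) oseledets x j) ;
  block_equivariant : forall i x j, regular_set x -> (j < nblocks x)%N ->
    (linfun (tangent_map X (generator T i) x) @: oseledets x j)%VS =
    oseledets (generator T i x) j ;
  exponent_invariant : forall i i' x j, regular_set x -> (j < nblocks x)%N ->
    exponent i j (generator T i' x) = exponent i j x ;
  (* f_1^(t_1) o ... o f_k^(t_k) is [T t], and its n-th iterate is
     [T (t *~ n)] *)
  exponentP : forall (t : 'rV[int]_k) x j u,
    regular_set x -> (j < nblocks x)%N -> u \in oseledets x j -> u != 0 ->
    cvg_two_sided
      (fun n => n%:~R^-1 *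
         ln (tangent_norm g (T (t *~ n) x) (tangent_map X (T (t *~ n)) x u)))
      (\sum_r (t 0 r)%:~R * exponent r j x) }.

Record random_exponents (R : realType) (M : ptopologicalType) (d k : nat)
    (X : closed_manifold R M d) (g : riemannian_metric X)
    (T : C1_action X k.+1) (mu : probability (borel M) R)
    (P : probability (bisequences k) R) (S : lyapunov_spectrum g T mu) :=
  RandomExponents {
  random_regular : set (bisequences k * borel M) ;
  random_exponent : nat -> bisequences k * borel M -> R ;
  random_regular_measurable : measurable random_regular ;
  random_regular_sub : random_regular `<=` setT `*` regular_set S ;
  random_regular_full : (P \x mu)%E random_regular = 1%E ;
  random_regular_forward :
    skew_product T @` random_regular `<=` random_regular ;
  random_exponentP : forall w x j u,
    random_regular (w, x) -> (j < nblocks S x)%N ->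
    u \in oseledets S x j -> u != 0 ->
    cvg_two_sided
      (fun n => n%:~R^-1 *
         ln (tangent_norm g (phi_iter T n w x)
               (tangent_map X (phi_iter T n w) x u)))
      (random_exponent j (w, x)) }.

(* Main.v *)
Require Import Defs.
From HB Require Import structures.
From mathcomp Require Import all_boot all_order all_algebra.
From mathcomp Require Import all_classical all_reals all_analysis.
From mathcomp Require Import measurable_realfun lra ring.
Set Implicit Arguments.
Unset Strict Implicit.
Unset Printing Implicit Defensive.
Import Order.TTheory GRing.Theory Num.Theory.
Import numFieldNormedType.Exports.
Local Open Scope classical_set_scope.
Local Open Scope ring_scope.

(** Fix a regular point x and a vector u <> 0 in E_j(x), and put
    F(a) = ln |D(T^a)(x) u| for a in Z^(k+1).  Since the generators commute,
    the random composition of length n is T^(N_n(w)), where N_n(w) counts how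
    often each label occurs among w_0, ..., w_(n-1).  So lambda_j(w, x) is the
    limit of F(N_n(w)) / n, while the spectrum of T only gives the limits
    F(n t) / n -> sum_i t_i lambda_(i,j)(x) along the rays of Z^(k+1).

    Two facts bridge the gap between the random path N_n(w) and the rays.

    - F is Lipschitz on Z^(k+1) ([log_growth_lipschitz]).  By compactness, the
      tangent map of a C^1 self-map of M is bounded for the Riemannian norm
      ([tangent_map_bound]); applied to T^b and to T^(-b), this makes the
      increments F(b + a) - F(a) bounded, uniformly in a, for each b.

    - By the law of large numbers N_n(w) / n is close to (m_i)_i.  As the limit
      lambda_j(w, x) is known to exist, arbitrarily large times n suffice, and
      these come from a second moment bound
      ([ae_small_infinitely_often], [variance_occurrences]).

    Given s, let t_i be the integer part of 2^s m_i.  Along n = 2^p the point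
    N_n(w) is at distance at most n (eps + O(2^-s)) from 2^(p-s) t, which lies
    on the ray of t, and F / n there tends to 2^-s sum_i t_i lambda_(i,j)(x),
    itself within O(2^-s) of sum_i m_i lambda_(i,j)(x).  Letting eps tend to 0
    and s to infinity gives the formula ([growth_rate_of_ray_rates]).  Powers
    of 2 are used so that 2^s divides n. *)

(** * Differentials, sums and row vectors *)

(** A differential depends only on the germ of the function; this is what allows
    maps to be rewritten on the domain of a chart. *)
Lemma diff_near_eq (R : realType) (V W : normedModType R) (f g : V -> W) x :
  {near x, f =1 g} -> differentiable g x ->
  differentiable f x /\ 'd f x = 'd g x :> (V -> W).
Proof.
move=> fg dg.
have fgx : f x = g x := nbhs_singleton fg.
have exf : f \o shift x = cst (f x) + 'd g x +o_ 0 id.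
  apply/eqaddoP => e e0.
  have /eqaddoP/(_ e e0) := diff_locally dg.
  have : \forall y \near (0 : V), f (y + x) = g (y + x).
    have : \forall y \near x, f y = g y := fg.
    by rewrite (near_shift 0 x) subr0.
  apply: filterS2 => y /= fgy.
  by rewrite !fctE /= fgx fgy.
have dfg := diff_unique (diff_continuous dg) exf.
split=> //; apply/diff_locallyP; rewrite dfg; split => //.
exact: diff_continuous.
Qed.

Lemma diff_comp_near (R : realType) (U V W : normedModType R) (F : U -> V)
    (G : V -> W) (H : U -> W) x y : F x = y -> {near x, H =1 G \o F} ->
  differentiable F x -> differentiable G y ->
  'd H x = 'd G y \o 'd F x :> (U -> W).
Proof.
move=> <- HGF dF dG.
by rewrite (diff_near_eq HGF (differentiable_comp dF dG)).2 diff_comp.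
Qed.

Lemma continuous_at_sum (R : realType) (I : finType) (T : topologicalType)
    (f : I -> T -> R) x : (forall i, {for x, continuous (f i)}) ->
  {for x, continuous (fun y => \sum_i f i y)}.
Proof.
move=> fx; apply: (@cvg_big _ _ _ _ _ _ _ (nbhs x)) => //.
  exact: pseudometric_normed_Zmodule.add_continuous.
by move=> i _; exact: fx.
Qed.

Lemma ler_entry_norm (R : realType) n (u : 'rV[R]_n) i : `|u 0 i| <= `|u|.
Proof.
have /mapP[j Hj ->] : `|u 0 i| \in [seq `|u x.1 x.2| | x : 'I_1 * 'I_n].
  by apply/mapP; exists (0, i) => //=; rewrite mem_enum.
by rewrite [leRHS]/Num.norm /= mx_normrE; apply/bigmax_geP; right => /=; exists j.
Qed.

(** * Comparison of quadratic forms *)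

Section QuadraticForms.
Context (R : realType) (d : nat).
Implicit Types (A B : 'M[R]_d) (u v : 'rV[R]_d).

Definition entry_norm A : R := \sum_i \sum_j `|A i j|.

Lemma bilinear_ofE A u v :
  bilinear_of A u v = \sum_i \sum_j u 0 j * A j i * v 0 i.
Proof.
rewrite /bilinear_of mxE; apply: eq_bigr => i _.
by rewrite !mxE big_distrl.
Qed.

Lemma bilinear_ofB A B u v :
  bilinear_of (A - B) u v = bilinear_of A u v - bilinear_of B u v.
Proof. by rewrite /bilinear_of mulmxBr mulmxBl !mxE. Qed.

Lemma bilinear_of_conj A B u v :
  bilinear_of (B *m A *m B^T) u v = bilinear_of A (u *m B) (v *m B).
Proof. by rewrite /bilinear_of trmx_mul !mulmxA. Qed.

Lemma conj_mxE A B i j :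
  (B *m A *m B^T) i j = \sum_a (\sum_b B i b * A b a) * B j a.
Proof. by rewrite mxE; apply: eq_bigr => a _; rewrite !mxE. Qed.

Lemma bilinear_of_delta A i j :
  bilinear_of A (delta_mx 0 i) (delta_mx 0 j) = A i j.
Proof. by rewrite /bilinear_of trmx_delta -rowE -colE !mxE. Qed.

Lemma bilinear_of_le A u : `|bilinear_of A u u| <= entry_norm A * `|u| ^+ 2.
Proof.
rewrite bilinear_ofE (le_trans (ler_norm_sum _ _ _)) //.
rewrite /entry_norm exchange_big /= mulr_suml ler_sum // => i _.
rewrite (le_trans (ler_norm_sum _ _ _)) // mulr_suml ler_sum // => j _.
rewrite !normrM mulrAC mulrC ler_wpM2l // expr2.
by rewrite ler_pM // ler_entry_norm.
Qed.

(** On the compact unit sphere a positive form attains a positive minimum.  The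
    sphere is empty when [d = 0]. *)
Lemma positive_form_coercive A : (forall u, u != 0 -> 0 < bilinear_of A u u) ->
  exists2 e, 0 < e & forall u, e * `|u| ^+ 2 <= bilinear_of A u u.
Proof.
move=> Apos; pose S := [set u : 'rV[R]_d | `|u| = 1].
have normc : continuous (fun u : 'rV[R]_d => `|u|) by exact: norm_continuous.
have cS : compact S.
  apply: bounded_closed_compact.
    exists 1; split; first exact: num_real.
    by move=> x x1 u /= ->; exact: ltW.
  have -> : S = (fun u : 'rV[R]_d => `|u|) @^-1` [set 1] by [].
  by apply: closed_comp => // x _; exact: normc.
have qc : continuous (fun u => bilinear_of A u u).
  rewrite (funext (fun u => bilinear_ofE A u u)) => u.
  apply: continuous_at_sum => i; apply: continuous_at_sum => j.
  apply: (@cvgM _ _ (nbhs u)); last exact: coord_continuous.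
  by apply: (@cvgM _ _ (nbhs u)); [exact: coord_continuous|exact: cvg_cst].
have [S0|/set0P/negP/negPn/eqP S0] := pselect (S !=set0); last first.
  exists 1 => // u; have [->|u0] := eqVneq u 0.
    by rewrite normr0 expr0n mulr0 /bilinear_of !mul0mx mxE.
  suff : S (`|u|^-1 *: u) by rewrite S0.
  by rewrite /S /= normrZ normfV normr_id mulVf // normr_eq0.
have [e eS emin] := compact_EVT_min S0 cS (continuous_subspaceT qc).
have e0 : e != 0.
  by move: eS; rewrite inE /S /= => e1; rewrite -normr_eq0 e1 oner_eq0.
exists (bilinear_of A e e); first exact: Apos.
move=> u; have [->|u0] := eqVneq u 0.
  by rewrite normr0 expr0n mulr0 /bilinear_of !mul0mx mxE.
have nu0 : `|u| != 0 by rewrite normr_eq0.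
have := emin (`|u|^-1 *: u); rewrite inE /S /= normrZ normfV normr_id mulVf //.
move=> /(_ erefl); rewrite {2}/bilinear_of linearZ /= -!scalemxAl -scalemxAr.
rewrite scalerA mxE -/(bilinear_of A u u) -expr2 exprVn mulrC.
by rewrite ler_pdivlMr // exprn_gt0 // normr_gt0.
Qed.

(** Near [x0] the entries of [H] are bounded, and those of [G] are so close to
    those of [G x0] that the form of [G] keeps half of the coercivity constant
    of [G x0]. *)
Lemma bilinear_of_local_bound (T : topologicalType) (G H : T -> 'M[R]_d) x0 :
  (forall i j, {for x0, continuous (fun x => G x i j)}) ->
  (forall i j, {for x0, continuous (fun x => H x i j)}) ->
  (forall u, u != 0 -> 0 < bilinear_of (G x0) u u) ->
  exists C, \forall x \near x0, forall u,
    bilinear_of (H x) u u <= C * bilinear_of (G x) u u.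
Proof.
move=> Gc Hc /positive_form_coercive[e e0 Ge].
pose K := entry_norm (H x0) + 1.
have K0 : 0 <= K by rewrite addr_ge0 // sumr_ge0 // => i _; rewrite sumr_ge0.
have HK : \forall x \near x0, entry_norm (H x) < K.
  have : {for x0, continuous (fun x => entry_norm (H x))}.
    apply: continuous_at_sum => i; apply: continuous_at_sum => j.
    apply: continuous_comp; last exact: norm_continuous.
    exact: Hc.
  by move=> /cvgr_lt; apply; rewrite ltrDl.
have Ge2 : \forall x \near x0, entry_norm (G x - G x0) < e / 2.
  have : {for x0, continuous (fun x => entry_norm (G x - G x0))}.
    apply: continuous_at_sum => i; apply: continuous_at_sum => j.
    apply: continuous_comp; last exact: norm_continuous.
    rewrite (_ : (fun x => _) = fun x => G x i j - G x0 i j); last first.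
      by apply/funext => x; rewrite !mxE.
    by apply: cvgB; [exact: Gc|exact: cvg_cst].
  move=> /cvgr_lt; apply; rewrite subrr /entry_norm big1 ?divr_gt0 // => i _.
  by rewrite big1 // => j _; rewrite mxE normr0.
exists (K / (e / 2)); near=> x => u.
have Hx : bilinear_of (H x) u u <= K * `|u| ^+ 2.
  rewrite (le_trans (ler_norm _)) // (le_trans (bilinear_of_le _ _)) //.
  by rewrite ler_wpM2r ?exprn_ge0 // ltW //; near: x.
apply: (le_trans Hx); rewrite -mulrA ler_wpM2l // ler_pdivlMl ?divr_gt0 //.
have : `|bilinear_of (G x - G x0) u u| <= e / 2 * `|u| ^+ 2.
  rewrite (le_trans (bilinear_of_le _ _)) //.
  by rewrite ler_wpM2r ?exprn_ge0 // ltW //; near: x.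
rewrite bilinear_ofB ler_norml => /andP[+ _].
have := Ge u; rewrite {1}[e]splitr mulrDl; lra.
Unshelve. all: by end_near. Qed.

End QuadraticForms.

(** * Tangent maps in charts and their boundedness *)

Section Charts.
Context (R : realType) (M : topologicalType) (d : nat).
Variable X : closed_manifold R M d.
Implicit Types (f g : M -> M) (c : chart R M d).

Lemma chart_rep_differentiable f c c' x : class_C_map X 1 f ->
  atlas X c -> atlas X c' -> chart_dom c x -> chart_dom c' (f x) ->
  differentiable (coords c' \o f \o param c) (coords c x).
Proof.
move=> [_ Cf] ac ac' cx c'x; have [dF _] := Cf _ _ ac ac'.
by apply: dF; exists x.
Qed.

Lemma class_C_map_id n : class_C_map X n (@idfun M).
Proof.
split; first by move=> x; exact: cvg_id.
by move=> c c' ac ac'; exact: (transition_smooth ac ac').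
Qed.

Lemma near_param c x (Q : set M) : chart_dom c x -> nbhs x Q ->
  \forall y \near coords c x, Q (param c y).
Proof.
move=> cx Qx; have : {for coords c x, continuous (param c)}.
  by apply: param_continuous; exists x.
by apply; rewrite /= coordsK.
Qed.

(** The chain rule for maps read in charts: the local representative of a
    composition agrees with the composition of the local representatives only
    near the point.  All the changes of charts below are instances where one of
    the maps is the identity. *)
Lemma diff_chart_comp f g c c' c'' x :
  class_C_map X 1 f -> class_C_map X 1 g ->
  atlas X c -> atlas X c' -> atlas X c'' ->
  chart_dom c x -> chart_dom c' (f x) -> chart_dom c'' (g (f x)) ->
  'd (coords c'' \o (g \o f) \o param c) (coords c x) =
  'd (coords c'' \o g \o param c') (coords c' (f x)) \o
  'd (coords c' \o f \o param c) (coords c x) :> ('rV[R]_d -> 'rV[R]_d).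
Proof.
move=> Cf Cg ac ac' ac'' cx cfx cgx.
have dF := chart_rep_differentiable Cf ac ac' cx cfx.
have dG := chart_rep_differentiable Cg ac' ac'' cfx cgx.
have Fx : (coords c' \o f \o param c) (coords c x) = coords c' (f x).
  by rewrite /= coordsK.
have near_Fx : {near coords c x, coords c'' \o (g \o f) \o param c =1
    (coords c'' \o g \o param c') \o (coords c' \o f \o param c)}.
  have c'near : \forall y \near x, chart_dom c' (f y).
    apply: (Cf.1 x); apply: open_nbhs_nbhs; split => //.
    exact: chart_dom_open.
  have := near_param cx c'near; apply: filterS => y c'y.
  by rewrite /= coordsK.
exact: (diff_comp_near Fx near_Fx dF dG).
Qed.

Lemma tangent_map_comp f g x u : class_C_map X 1 f -> class_C_map X 1 g ->
  tangent_map X (g \o f) x u = tangent_map X g (f x) (tangent_map X f x u).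
Proof.
move=> Cf Cg; have /(congr1 (@^~ u)) := diff_chart_comp Cf Cg
  (chart_at_atlas X x) (chart_at_atlas X (f x)) (chart_at_atlas X (g (f x)))
  (chart_at_dom X x) (chart_at_dom X (f x)) (chart_at_dom X (g (f x))).
exact.
Qed.

Lemma tangent_map_id x u : tangent_map X idfun x u = u.
Proof.
have near_id : {near coords (chart_at X x) x,
    coords (chart_at X x) \o idfun \o param (chart_at X x) =1 idfun}.
  have Hx : \forall y \near coords (chart_at X x) x,
      (coords (chart_at X x) @` chart_dom (chart_at X x)) y.
    apply: open_nbhs_nbhs; split; first exact: chart_codom_open.
    by exists x => //; exact: chart_at_dom.
  apply: filterS Hx => _ [z cz <-].
  by rewrite /= coordsK.
have id_diff := is_diff_id (coords (chart_at X x) x).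
have := (diff_near_eq near_id (@ex_diff _ _ _ _ _ _ _ id_diff)).2.
move=> /(congr1 (@^~ u)) E; apply: (etrans E).
exact: (congr1 (@^~ u) (@diff_val _ _ _ _ _ _ _ id_diff)).
Qed.

Lemma from_chartE c x v :
  from_chart X c x v = v *m 'J (coords (chart_at X x) \o param c) (coords c x).
Proof. by rewrite /from_chart /jacobian mul_rV_lin1. Qed.

Lemma from_chart_tangent_map f c x u : class_C_map X 1 f ->
  atlas X c -> chart_dom c (f x) ->
  tangent_map X f x u = from_chart X c (f x)
    ('d (coords c \o f \o param (chart_at X x)) (coords (chart_at X x) x) u).
Proof.
move=> Cf ac cfx; have /(congr1 (@^~ u)) := diff_chart_comp Cf (class_C_map_id 1)
  (chart_at_atlas X x) ac (chart_at_atlas X (f x))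
  (chart_at_dom X x) cfx (chart_at_dom X (f x)).
exact.
Qed.

Lemma tangent_map_from_chart f c c' x v : class_C_map X 1 f ->
  atlas X c -> atlas X c' -> chart_dom c x -> chart_dom c' (f x) ->
  tangent_map X f x (from_chart X c x v) =
  from_chart X c' (f x) (v *m 'J (coords c' \o f \o param c) (coords c x)).
Proof.
move=> Cf ac ac' cx c'fx; rewrite /jacobian mul_rV_lin1.
have Cid := class_C_map_id 1.
have /(congr1 (@^~ v)) := diff_chart_comp Cid Cf ac
  (chart_at_atlas X x) (chart_at_atlas X (f x))
  cx (chart_at_dom X x) (chart_at_dom X (f x)).
have /(congr1 (@^~ v)) := diff_chart_comp Cf Cid ac
  ac' (chart_at_atlas X (f x)) cx c'fx (chart_at_dom X (f x)).
by move=> fc' cf; exact: etrans (esym cf) fc'.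
Qed.

Section Metric.
Variable g : riemannian_metric X.

(** The Gram matrix of the metric in the fixed chart [c].  Unlike [gram], whose
    coordinates jump with [chart_at], it varies continuously on [chart_dom c]. *)
Definition chart_gram c x : 'M[R]_d :=
  let J := 'J (coords (chart_at X x) \o param c) (coords c x) in
  J *m gram g x *m J^T.

Lemma bilinear_of_chart_gram c x u v : bilinear_of (chart_gram c x) u v =
  bilinear_of (gram g x) (from_chart X c x u) (from_chart X c x v).
Proof. by rewrite bilinear_of_conj !from_chartE. Qed.

Lemma chart_gram_continuous c x i j : atlas X c -> chart_dom c x ->
  {for x, continuous (fun y => chart_gram c y i j)}.
Proof.
move=> ac cx; pose q y := bilinear_of (gram g (param c y))
  (from_chart X c (param c y) (delta_mx 0 i))
  (from_chart X c (param c y) (delta_mx 0 j)).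
have qE y : chart_dom c y -> q (coords c y) = chart_gram c y i j.
  by move=> cy; rewrite /q coordsK // -bilinear_of_chart_gram bilinear_of_delta.
have qc : {for coords c x, continuous q}.
  by apply: (gram_smooth g ac _ _ 0); exists x.
have qxc : {for x, continuous (q \o coords c)}.
  by apply: continuous_comp => //; exact: coords_continuous.
have {}qxc : (q \o coords c) y @[y --> x] --> chart_gram c x i j.
  by rewrite -qE //; exact: qxc.
apply: cvg_trans qxc; apply: near_eq_cvg.
apply: filterS (open_nbhs_nbhs (conj (@chart_dom_open _ _ _ c) cx)) => y cy.
by rewrite /= qE.
Qed.

Lemma chart_jacobian_continuous f c c' x i j : class_C_map X 1 f ->
  atlas X c -> atlas X c' -> chart_dom c x -> chart_dom c' (f x) ->
  {for x, continuous (fun y => 'J (coords c' \o f \o param c) (coords c y) i j)}.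
Proof.
move=> [_ Cf] ac ac' cx c'x; have [_ /(_ (delta_mx 0 i)) dFc] := Cf _ _ ac ac'.
have {}dFc : {for coords c x, continuous
    (fun y => 'd (coords c' \o f \o param c) y (delta_mx 0 i))}.
  by apply: dFc; exists x.
have := continuous_comp (coords_continuous cx) dFc.
move=> /continuous_comp/(_ (@coord_continuous R 1 d 0 j _)).
rewrite (_ : _ \o _ =
  fun y => 'J (coords c' \o f \o param c) (coords c y) i j) //.
by apply/funext => y; rewrite /= /jacobian -mul_rV_lin1 -rowE mxE.
Qed.

(** In the fixed charts around [x0] and [f x0] the Jacobian and both Gram
    matrices are continuous, so the two sides compare as quadratic forms; every
    tangent vector at a nearby [x] has components in the chart at [x0]. *)
Lemma tangent_map_local_bound f (x0 : M) : class_C_map X 1 f ->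
  exists C, \forall x \near x0, forall u,
    bilinear_of (gram g (f x)) (tangent_map X f x u) (tangent_map X f x u)
      <= C * bilinear_of (gram g x) u u.
Proof.
move=> Cf; set c := chart_at X x0; set c' := chart_at X (f x0).
have ac : atlas X c := chart_at_atlas X x0.
have ac' : atlas X c' := chart_at_atlas X (f x0).
have cx0 : chart_dom c x0 := chart_at_dom X x0.
have c'x0 : chart_dom c' (f x0) := chart_at_dom X (f x0).
pose J x := 'J (coords c' \o f \o param c) (coords c x).
pose H x := J x *m chart_gram c' (f x) *m (J x)^T.
have Jc i j : {for x0, continuous (fun x => J x i j)}.
  exact: chart_jacobian_continuous.
have Gc i j : {for x0, continuous (fun x => chart_gram c x i j)}.
  exact: chart_gram_continuous.
have Hc i j : {for x0, continuous (fun x => H x i j)}.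
  rewrite (_ : (fun x => _) = fun x => \sum_a (\sum_b J x i b *
      chart_gram c' (f x) b a) * J x j a); last first.
    by apply/funext => x; exact: conj_mxE.
  apply: continuous_at_sum => a.
  apply: (@cvgM _ _ (nbhs x0)); last exact: Jc.
  apply: continuous_at_sum => b.
  apply: (@cvgM _ _ (nbhs x0)); first exact: Jc.
  apply: (@continuous_comp _ _ _ f (fun y => chart_gram c' y b a)).
    exact: Cf.1.
  exact: chart_gram_continuous.
have surj x u : chart_dom c x -> exists v, u = from_chart X c x v.
  move=> cx; exists ('d (coords c \o idfun \o param (chart_at X x))
    (coords (chart_at X x) x) u).
  apply: (etrans (esym (tangent_map_id x u))).
  exact: (from_chart_tangent_map u (class_C_map_id 1) ac cx).
have Gpos u : u != 0 -> 0 < bilinear_of (chart_gram c x0) u u.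
  (* [c] is the chart selected at [x0], so this is the tangent map of the
     identity. *)
  have from_c : from_chart X c x0 u = u := tangent_map_id x0 u.
  by move=> u0; rewrite bilinear_of_chart_gram from_c gram_pos.
have [C HC] := bilinear_of_local_bound Gc Hc Gpos; exists C.
near=> x => u.
have cx : chart_dom c x.
  by near: x; apply: open_nbhs_nbhs; split => //; exact: chart_dom_open.
have c'x : chart_dom c' (f x).
  near: x; apply: (Cf.1 x0); apply: open_nbhs_nbhs; split => //.
  exact: chart_dom_open.
have [v ->] := surj x u cx.
rewrite (tangent_map_from_chart _ Cf ac ac' cx c'x).
have HE := etrans (bilinear_of_conj (chart_gram c' (f x)) (J x) v v)
  (bilinear_of_chart_gram c' (f x) (v *m J x) (v *m J x)).
have HGv : bilinear_of (H x) v v <= C * bilinear_of (chart_gram c x) v v.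
  by move: v {HE}; near: x.
have GE := bilinear_of_chart_gram c x v v.
exact: etrans (congr2 (fun a b => a <= C * b) (esym HE) (esym GE)) HGv.
Unshelve. all: by end_near. Qed.

(** The local bounds are monotone in the constant, so compactness yields a
    common one. *)
Lemma tangent_map_bound f : class_C_map X 1 f ->
  exists2 C, 0 < C & forall x u,
    tangent_norm g (f x) (tangent_map X f x u) <= C * tangent_norm g x u.
Proof.
move=> Cf; pose q x u := bilinear_of (gram g x) u u.
pose P C x := forall u, q (f x) (tangent_map X f x u) <= C * q x u.
have q0 x u : 0 <= q x u.
  have [->|u0] := eqVneq u 0; first by rewrite /q /bilinear_of !mul0mx mxE.
  by rewrite ltW // gram_pos.
have : \forall C \near +oo, [set: M] `<=` P C.
  have /compact_near_coveringP := manifold_compact X; apply => x _.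
  have [C0 HC0] := tangent_map_local_bound x Cf.
  have C0C : \forall C \near +oo, C0 <= C.
    by apply: nbhs_pinfty_ge; exact: num_real.
  exists ([set y | forall u, q (f y) (tangent_map X f y u) <= C0 * q y u],
      [set C | C0 <= C]) => //= -[y C] [/= Hy C0C'] u.
  by rewrite (le_trans (Hy u)) // ler_wpM2r.
move=> bound; have ge1 : \forall C \near +oo, (1 : R) <= C.
  by apply: nbhs_pinfty_ge; exact: num_real.
have [C [PC C1]] := filter_ex (filterI bound ge1).
have C0 : 0 < C := lt_le_trans ltr01 C1.
exists (Num.sqrt C) => [|x u]; first by rewrite sqrtr_gt0.
by rewrite /tangent_norm -sqrtrM ?(ltW C0) // ler_wsqrtr //; exact: PC.
Qed.

End Metric.

End Charts.

(** * Functions of bounded increments on a lattice *)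

Section Lattice.
Context (R : realType) (k : nat).
Implicit Types (F : 'rV[int]_k -> R) (a b t : 'rV[int]_k).

(** Walk from [b] to [a] along the coordinate directions, one unit at a time. *)
Lemma lipschitz_lattice F K :
  (forall i a, `|F (delta_mx 0 i + a) - F a| <= K) ->
  forall a b, `|F a - F b| <= K * \sum_i `|(a 0 i - b 0 i)%:~R|.
Proof.
move=> step.
have nat_ray i (n : nat) a : `|F (n%:Z *: delta_mx 0 i + a) - F a| <= K * n%:R.
  elim: n => [|n IHn]; first by rewrite scale0r add0r subrr normr0 mulr0.
  rewrite intS scalerDl scale1r -addrA mulrSr mulrDr mulr1 [leRHS]addrC.
  rewrite -(subrKA (F (n%:Z *: delta_mx 0 i + a))).
  by rewrite (le_trans (ler_normD _ _)) // lerD.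
have ray i (z : int) a :
    `|F (z *: delta_mx 0 i + a) - F a| <= K * `|z%:~R|.
  case: z => n; first by rewrite -pmulrn normr_nat.
  rewrite NegzE mulrNz normrN -pmulrn normr_nat distrC.
  have := nat_ray i n.+1 (- n.+1%:Z *: delta_mx 0 i + a).
  by rewrite addrA -scalerDl subrr scale0r add0r.
have sum_rays (s : seq 'I_k) (z : 'I_k -> int) a :
    `|F (\sum_(i <- s) z i *: delta_mx 0 i + a) - F a| <=
    \sum_(i <- s) K * `|(z i)%:~R|.
  elim: s => [|i s IHs]; first by rewrite !big_nil add0r subrr normr0.
  rewrite !big_cons -addrA.
  rewrite -(subrKA (F (\sum_(j <- s) z j *: delta_mx 0 j + a))).
  by rewrite (le_trans (ler_normD _ _)) // lerD.
move=> a b; have := sum_rays (index_enum 'I_k) (fun i => (a - b) 0 i) b.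
rewrite -row_sum_delta subrK mulr_sumr => /le_trans; apply.
by rewrite ler_sum // => i _; rewrite !mxE.
Qed.

(** Along [n = 2 ^ p] the point [N n] is compared with the point [2 ^ (p - s)] of
    the ray through [t], where [t] is the integer part of [2 ^ s * m]: the
    Lipschitz estimate for [F] transfers the rate along the ray to [N]. *)
Lemma growth_rate_of_ray_rates F K (lam m : 'I_k -> R) (l : R)
    (N : nat -> 'rV[int]_k) : 0 <= K ->
  (forall i a, `|F (delta_mx 0 i + a) - F a| <= K) ->
  (forall t, (fun n => n%:R^-1 * F (t *+ n)) @ \oo -->
     \sum_i (t 0 i)%:~R * lam i) ->
  (fun n => n%:R^-1 * F (N n)) @ \oo --> l ->
  (forall e, 0 < e -> forall p0, exists2 p, (p0 <= p)%N &
     forall i, `|(N (2 ^ p)%N 0 i)%:~R / (2 ^ p)%:R - m i| <= e) ->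
  l = \sum_i m i * lam i.
Proof.
move=> K0 step rays liml freq.
have lip := lipschitz_lattice step.
(* The final error is at most [B * eta]: one [eta] from each of the two limits,
   [2 * K * k * eta] from the Lipschitz estimate, and the last sum from
   replacing [m] by [t / q]. *)
pose B := 2 + 2 * K * k%:R + \sum_i `|lam i|.
have B0 : 0 < B.
  by rewrite ltr_wpDr ?sumr_ge0 // ltr_wpDr // mulr_ge0 // mulr_ge0.
apply/eqP; rewrite -subr_eq0 -normr_le0; apply/ler_addgt0Pl => e e0.
rewrite addr0; pose eta := e / B.
have eta0 : 0 < eta by rewrite divr_gt0.
have [s qs] : exists s, (2 ^ s)%:R^-1 <= eta.
  exists (Num.trunc eta^-1).+1; rewrite invf_ple ?posrE ?ltr0n ?expn_gt0 //.
  apply: (le_trans (ltW (truncnS_gt _))).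
  by rewrite ler_nat ltnW // ltn_expl.
pose q : R := (2 ^ s)%:R.
have q0 : 0 < q by rewrite ltr0n expn_gt0.
pose t : 'rV[int]_k := \row_i Num.floor (q * m i).
have tm i : `|m i - (t 0 i)%:~R / q| <= eta.
  apply: le_trans qs; rewrite mxE.
  have /andP[fle flt] := floor_itv (q * m i).
  move: (Num.floor _) fle flt => y fle flt.
  rewrite (_ : _ - _ = (q * m i - y%:~R) / q); last by field; exact: lt0r_neq0.
  rewrite normrM normfV (gtr0_norm q0) ler_piMl ?invr_ge0 ?(ltW q0) //.
  by move: flt; rewrite intrD ler_norml; lra.
pose v := \sum_i (t 0 i)%:~R * lam i.
have [r0 _ Hr0] := cvgr_distC_le _ _ (rays t) _ eta0.
have [n0 _ Hn0] := cvgr_distC_le _ _ liml _ eta0.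
(* The bound on [p] makes both [2 ^ p] and [2 ^ (p - s)] large enough for the
   two limits to be within [eta]. *)
have [p pge Np] := freq eta eta0 (s + r0 + n0)%N.
have sp : (s <= p)%N by rewrite (leq_trans _ pge) // -addnA leq_addr.
pose n := (2 ^ p)%N; pose r := (2 ^ (p - s))%N.
have nqr : n%:R = q * r%:R by rewrite /q -natrM -expnD subnKC.
have r0r : 0 < r%:R :> R by rewrite ltr0n expn_gt0.
have n0r : 0 < n%:R :> R by rewrite ltr0n expn_gt0.
have {}Hr0 : `|r%:R^-1 * F (t *+ r) - v| <= eta.
  apply: Hr0; rewrite /= (leq_trans _ (ltnW (ltn_expl _ (ltnSn 1)))) //.
  by rewrite leq_subRL // (leq_trans _ pge) // leq_addr.
have {}Hn0 : `|n%:R^-1 * F (N n) - l| <= eta.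
  apply: Hn0; rewrite /= (leq_trans _ (ltnW (ltn_expl _ (ltnSn 1)))) //.
  by rewrite (leq_trans _ pge) // leq_addl.
have FN : `|n%:R^-1 * F (N n) - n%:R^-1 * F (t *+ r)| <= 2 * K * k%:R * eta.
  rewrite -mulrBr normrM gtr0_norm ?invr_gt0 // mulrC ler_pdivrMr //.
  apply: (le_trans (lip _ _)).
  rewrite (_ : _ * _ * eta * _ = K * (\sum_(i < k) 2 * eta * n%:R)); last first.
    rewrite sumr_const card_ord -mulr_natr; ring.
  rewrite ler_wpM2l // ler_sum // => i _.
  rewrite (_ : (_ - _)%:~R = ((N n 0 i)%:~R / n%:R - m i +
    (m i - (t 0 i)%:~R / q)) * n%:R); last first.
    rewrite intrB mulmxnE rmorphMn /= -mulr_natr.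
    rewrite [in RHS]mulrDl !mulrBl divfK ?lt0r_neq0 // nqr; field.
    exact: lt0r_neq0.
  rewrite normrM (gtr0_norm n0r) ler_wpM2r ?(ltW n0r) //.
  by rewrite (le_trans (ler_normD _ _)) // mulr2n mulrDl mul1r lerD // Np.
have Ft : `|n%:R^-1 * F (t *+ r) - v / q| <= eta.
  rewrite (_ : _ - _ = (r%:R^-1 * F (t *+ r) - v) / q); last first.
    by rewrite nqr; field; rewrite !lt0r_neq0.
  rewrite normrM normfV (gtr0_norm q0) ler_pdivrMr // (le_trans Hr0) //.
  by rewrite ler_peMr ?(ltW eta0) // ler1n expn_gt0.
have vm : `|v / q - \sum_i m i * lam i| <= (\sum_i `|lam i|) * eta.
  rewrite !mulr_suml -sumrB (le_trans (ler_norm_sum _ _ _)) // ler_sum // => i _.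
  rewrite (_ : _ - _ = lam i * ((t 0 i)%:~R / q - m i)); last by ring.
  by rewrite normrM ler_wpM2l // distrC.
have eB : e = eta + 2 * K * k%:R * eta + eta + (\sum_i `|lam i|) * eta.
  by rewrite -[LHS](divfK (lt0r_neq0 B0)) -/eta /B; ring.
rewrite eB; move: Hn0 FN Ft vm.
rewrite !ler_norml.
lra.
Qed.

End Lattice.

(** * Growth of a tangent vector under the action *)

Section LogGrowth.
Context (R : realType) (M : topologicalType) (d k : nat).
Variables (X : closed_manifold R M d) (g : riemannian_metric X).
Variable T : C1_action X k.
Implicit Types (x : M) (u : 'rV[R]_d) (a b : 'rV[int]_k).

Definition log_growth x u a : R :=
  ln (tangent_norm g (T a x) (tangent_map X (T a) x u)).

Lemma tangent_norm_gt0 x u : u != 0 -> 0 < tangent_norm g x u.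
Proof. by move=> u0; rewrite sqrtr_gt0; exact: gram_pos. Qed.

Lemma tangent_map_zkD a b x u : tangent_map X (T (a + b)) x u =
  tangent_map X (T a) (T b x) (tangent_map X (T b) x u).
Proof.
rewrite (_ : zk_map T (a + b) = zk_map T a \o zk_map T b).
  exact: tangent_map_comp (zk_map_C1 T b) (zk_map_C1 T a).
by apply/funext => y; exact: zk_mapD.
Qed.

(** The tangent map of [T (- a)] is a left inverse of that of [T a]. *)
Lemma tangent_map_zk_neq0 a x u : u != 0 -> tangent_map X (T a) x u != 0.
Proof.
apply: contraNneq => Du0; apply/eqP.
have T0 : zk_map T 0 = idfun by apply/funext => y; exact: zk_map0.
have E : tangent_map X (T (- a + a)) x u = u.
  by rewrite addNr T0; exact: tangent_map_id.
apply: (etrans (esym E)); apply: (etrans (tangent_map_zkD (- a) a x u)).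
exact: (etrans (congr1 (tangent_map X (T (- a)) (T a x)) Du0) (linear0 _)).
Qed.

(** The bound of the tangent map of [T b] controls the increment from above, that
    of [T (- b)] from below. *)
Lemma log_growth_step b : exists K, forall x u a, u != 0 ->
  `|log_growth x u (b + a) - log_growth x u a| <= K.
Proof.
have bound c : exists K, forall x u a, u != 0 ->
    log_growth x u (c + a) - log_growth x u a <= K.
  have [C C0 HC] := tangent_map_bound g (zk_map_C1 T c).
  exists (ln C) => x u a u0.
  have pos e : 0 < tangent_norm g (T e x) (tangent_map X (T e) x u).
    by rewrite tangent_norm_gt0 // tangent_map_zk_neq0.
  rewrite lerBlDr /log_growth -lnM ?posrE // ler_ln ?posrE ?mulr_gt0 //.
  have normE := congr2 (tangent_norm g) (zk_mapD T c a x)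
    (tangent_map_zkD c a x u).
  exact: (etrans (congr1 (fun r => r <= C * _) normE) (HC _ _)).
have [K1 HK1] := bound b; have [K2 HK2] := bound (- b).
exists (Num.max K1 K2) => x u a u0.
have := HK2 x u (b + a) u0; rewrite (addKr b a); have := HK1 x u a u0.
move: (log_growth x u (b + a)) (log_growth x u a) => y z yz zy.
by rewrite ler_norml lerNl opprB !le_max yz zy orbT.
Qed.

Lemma log_growth_lipschitz : exists2 K, 0 <= K & forall x u, u != 0 ->
  forall (i : 'I_k) a,
    `|log_growth x u (delta_mx 0 i + a) - log_growth x u a| <= K.
Proof.
have /choice[K HK] : forall i : 'I_k, exists K, forall x u a, u != 0 ->
    `|log_growth x u (delta_mx 0 i + a) - log_growth x u a| <= K.
  by move=> i; exact: log_growth_step.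
exists (\sum_i `|K i|) => [|x u u0 i a]; first by rewrite sumr_ge0.
rewrite (le_trans (HK i x u a u0)) // (le_trans (ler_norm _)) //.
by rewrite (bigD1 i) //= lerDl sumr_ge0.
Qed.

End LogGrowth.

(** * Random compositions as elements of the action *)

Section Visits.
Context (R : realType) (M : ptopologicalType) (d k : nat).
Variables (X : closed_manifold R M d) (T : C1_action X k.+1).
Implicit Types (w : bisequences k) (i : labels k).

Definition visits n w i : nat := \sum_(p < n) (w p%:Z == i).

Definition label_counts n w : 'rV[int]_k.+1 := \row_i (visits n w i)%:Z.

Lemma label_countsS n w :
  label_counts n.+1 w = delta_mx 0 (w n%:Z) + label_counts n w.
Proof.
apply/rowP => i; rewrite !mxE /visits big_ord_recr /= PoszD addrC.
by rewrite eq_sym; case: eqP.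
Qed.

Lemma forwardE n w : forward T n w = zk_map T (label_counts n w).
Proof.
elim: n => [|n IHn]; apply/funext => x /=.
  rewrite (_ : label_counts 0 w = 0) ?zk_map0 //.
  by apply/rowP => i; rewrite !mxE /visits big_ord0.
by rewrite label_countsS zk_mapD IHn /phi /shift_seq add0r.
Qed.

(** The deterministic part of the theorem: the limit defining the random exponent
    exists by assumption, so frequencies are needed only at arbitrarily large
    times. *)
Lemma random_exponent_eq (g : riemannian_metric X)
    (mu : probability (borel M) R) (m : 'I_k.+1 -> R)
    (P : probability (bisequences k) R) (spec : lyapunov_spectrum g T mu)
    (L : random_exponents P spec) w x j :
  random_regular L (w, x) -> (j < nblocks spec x)%N ->
  (forall e, 0 < e -> forall p0, exists2 p, (p0 <= p)%N &
     forall i, `|(visits (2 ^ p) w i)%:R / (2 ^ p)%:R - m i| <= e) ->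
  random_exponent L j (w, x) = \sum_i m i * exponent spec i j x.
Proof.
move=> Lwx jx freq; have [_ /= xreg] := random_regular_sub Lwx.
have uE : vpick (oseledets spec x j) \in oseledets spec x j := memv_pick _.
have u0 : vpick (oseledets spec x j) != 0.
  by rewrite vpick0; exact: block_neq0.
move: (vpick _) uE u0 => u uE u0.
have [K K0 HK] := log_growth_lipschitz g T.
apply: (@growth_rate_of_ray_rates R k.+1 (log_growth g T x u) K
  (fun i => exponent spec i j x) m _ (label_counts ^~ w) K0 (HK x u u0)).
- by move=> t; have [+ _] := exponentP t xreg jx uE u0.
- have [cv _] := random_exponentP Lwx jx uE u0.
  apply: cvg_trans cv; apply/near_eq_cvg/nearW => n.
  exact: (congr1 (fun f => n%:R^-1 *
    ln (tangent_norm g (f x) (tangent_map X f x u))) (forwardE n w)).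
- move=> e e0 p0; have [p pp0 Hp] := freq e e0 p0; exists p => // i.
  by rewrite mxE; exact: Hp.
Qed.

End Visits.

(** * Frequencies of independent events *)

(** For each [n0] the function [inf_(n >= n0) f n] has integral zero, hence
    vanishes almost everywhere. *)
Lemma ae_small_infinitely_often (R : realType) d (T : measurableType d)
    (mu : measure T R) (f : nat -> T -> R) :
  (forall n, measurable_fun setT (f n)) -> (forall n x, 0 <= f n x) ->
  (fun n => \int[mu]_x (f n x)%:E)%E @ \oo --> 0%E ->
  {ae mu, forall x, forall e, 0 < e -> forall n0,
    exists2 n, (n0 <= n)%N & f n x <= e}.
Proof.
move=> mf f0 intf0.
pose tail_inf n0 x := einfs (fun n => (f n x)%:E) n0.
have mfE n : measurable_fun setT (EFin \o f n).
  exact/measurable_EFinP.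
have minf n0 : measurable_fun setT (tail_inf n0).
  exact: measurable_fun_einfs.
have inf0 n0 x : (0 <= tail_inf n0 x)%E.
  by apply/ereal_infP => _ [p _ <-]; rewrite lee_fin.
have inf_ae0 n0 : ae_eq mu setT (tail_inf n0) (cst 0%E).
  apply/ae_eq_integral_abs => //; apply/eqP; rewrite eq_le integral_ge0 // andbT.
  under eq_integral do rewrite gee0_abs //.
  apply: (cvge_to_ge intf0); near=> p; apply: ge0_le_integral => //.
  - exact: mfE.
  - move=> x _; apply: ereal_inf_lbound; exists p => //=.
    by near: p; exact: nbhs_infty_ge.
have := ae_foralln inf_ae0; apply: filterS => x inf_x e e0 n0.
have : (tail_inf n0 x < e%:E)%E by rewrite inf_x // lte_fin.
by move=> /ereal_inf_lt[_ [p n0p <-]]; rewrite lte_fin => /ltW ?; exists p.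
Unshelve. all: by end_near. Qed.

Section PairwiseIndependentEvents.
Context (R : realType) d (T : measurableType d) (P : probability T R).
Variables (A : nat -> set T) (rho : R).
Hypothesis mA : forall p, measurable (A p).
Hypothesis PA : forall p, P (A p) = rho%:E.
Hypothesis PAI : forall p q, p != q -> P (A p `&` A q) = (rho * rho)%:E.

Lemma measurable_occurrences n :
  measurable_fun setT (fun x => \sum_(p < n) \1_(A p) x : R).
Proof.
by apply: measurable_sum => p; exact: measurable_indic.
Qed.

(** Write [V] for the number of occurrences.  To integrate nonnegative functions
    only, the expansion of the square is used in the form
    [(V - n rho)^2 + 2 n rho V = V^2 + (n rho)^2]. *)
Lemma variance_occurrences n :
  (\int[P]_x ((\sum_(p < n) \1_(A p) x - n%:R * rho) ^+ 2)%:E =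
   (n%:R * (rho - rho ^+ 2))%:E)%E.
Proof.
pose V x : R := \sum_(p < n) \1_(A p) x.
have rho0 : 0 <= rho by rewrite -lee_fin -(PA 0).
have V0 x : 0 <= V x by rewrite sumr_ge0.
have mV : measurable_fun setT V := measurable_occurrences n.
have EV : (\int[P]_x (V x)%:E = (n%:R * rho)%:E)%E.
  under eq_integral do rewrite /V -sumEFin.
  rewrite ge0_integral_sum //; last first.
    by move=> p; apply/measurable_EFinP; exact: measurable_indic.
  rewrite (eq_bigr (fun=> rho%:E)) => [|p _]; last first.
    by rewrite integral_indic // setIT; exact: PA.
  by rewrite sumEFin sumr_const card_ord mulr_natl.
have EV2 : (\int[P]_x (V x ^+ 2)%:E =
    (n%:R * rho + n%:R * (n%:R - 1) * rho ^+ 2)%:E)%E.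
  rewrite (eq_integral (fun x => \sum_(p < n) \sum_(q < n)
      (\1_(A p `&` A q) x)%:E)%E); last first.
    move=> x _; rewrite expr2 /V mulr_suml -sumEFin; apply: eq_bigr => p _.
    rewrite mulr_sumr -sumEFin; apply: eq_bigr => q _.
    by rewrite indicI.
  have mI p q : measurable (A p `&` A q) by exact: measurableI.
  rewrite ge0_integral_sum //; last 2 first.
  - move=> p; apply: emeasurable_sum => q; apply/measurable_EFinP.
    exact: measurable_indic.
  - by move=> p x _; apply: sume_ge0 => q _; rewrite lee_fin.
  rewrite (eq_bigr (fun=> (rho + (n%:R - 1) * rho ^+ 2)%:E)); last first.
    move=> p _; rewrite ge0_integral_sum //; last first.
      by move=> q; apply/measurable_EFinP; exact: measurable_indic.
    under eq_bigr do rewrite integral_indic // setIT.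
    rewrite (bigD1 p) //= setIid (eq_bigr (fun=> (rho * rho)%:E)); last first.
      by move=> q qp; apply: PAI; rewrite eq_sym.
    rewrite (_ : _ (A p) = rho%:E); last exact: PA.
    rewrite sumEFin sumr_const -EFinD; congr (_ + _)%:E.
    rewrite cardC1 card_ord -[_ * _ *+ _]mulr_natl expr2; congr (_ * _).
    by rewrite -subn1 natrB // (leq_ltn_trans _ (ltn_ord p)).
  rewrite sumEFin sumr_const card_ord -mulr_natl; congr EFin; ring.
pose I := (\int[P]_x ((V x - n%:R * rho) ^+ 2)%:E)%E.
suff: I = (n%:R * (rho - rho ^+ 2))%:E by [].
have mI : measurable_fun setT (fun x => (V x - n%:R * rho) ^+ 2).
  by apply: measurable_funX; apply: measurable_funB.
have c0 : 0 <= 2 * n%:R * rho by rewrite !mulr_ge0.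
have : (I + (2 * n%:R * rho)%:E * (n%:R * rho)%:E =
    (n%:R * rho + n%:R * (n%:R - 1) * rho ^+ 2)%:E + ((n%:R * rho) ^+ 2)%:E)%E.
  rewrite -EV2 -EV -ge0_integralZl_EFin //; last 2 first.
  - by move=> x _; rewrite lee_fin.
  - exact/measurable_EFinP.
  have -> : ((n%:R * rho) ^+ 2)%:E =
      (\int[P]_x (cst ((n%:R * rho) ^+ 2)%:E x))%E.
    rewrite integral_cst // -[LHS]mule1; congr (_ * _)%E.
    exact/esym/probability_setT.
  rewrite /I -!ge0_integralD //; last first.
  - apply: measurable_funeM; exact/measurable_EFinP.
  - by move=> x _; rewrite mule_ge0 // lee_fin.
  - exact/measurable_EFinP.
  - by move=> x _; rewrite lee_fin sqr_ge0.
  - by move=> x _; rewrite lee_fin sqr_ge0.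
  - by apply/measurable_EFinP; apply: measurable_funX.
  - by move=> x _; rewrite lee_fin exprn_ge0.
  apply: eq_integral => x _; rewrite /= -EFinM -!EFinD.
  rewrite (_ : _ + _ * V x = V x ^+ 2 + (n%:R * rho) ^+ 2) //; ring.
rewrite -EFinM -EFinD; case: I => [r| |] //= [rE].
rewrite (_ : r = n%:R * (rho - rho ^+ 2)) //; lra.
Qed.

End PairwiseIndependentEvents.

(** The variance of the frequency at time [2 ^ p] is [O(2 ^- p)], and so tends
    to zero. *)
Lemma ae_frequencies (R : realType) d (T : measurableType d)
    (P : probability T R) (I : finType) (A : I -> nat -> set T) (rho : I -> R) :
  (forall i p, measurable (A i p)) ->
  (forall i p, P (A i p) = (rho i)%:E) ->
  (forall i p q, p != q -> P (A i p `&` A i q) = (rho i * rho i)%:E) ->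
  {ae P, forall x, forall e, 0 < e -> forall p0, exists2 p, (p0 <= p)%N &
    forall i, `|(\sum_(q < 2 ^ p) \1_(A i q) x) / (2 ^ p)%:R - rho i| <= e}.
Proof.
move=> mA PA PAI.
pose dev i p x : R := \sum_(q < 2 ^ p) \1_(A i q) x - (2 ^ p)%:R * rho i.
pose f p x : R := \sum_i (2 ^ p)%:R ^- 2 * dev i p x ^+ 2.
have n0 p : 0 < (2 ^ p)%:R :> R by rewrite ltr0n expn_gt0.
have mdev i p : measurable_fun setT (dev i p).
  by apply: measurable_funB => //; exact: measurable_occurrences.
have mterm i p : measurable_fun setT (fun x => (2 ^ p)%:R ^- 2 * dev i p x ^+ 2).
  by apply: measurable_funM => //; exact: measurable_funX.
have term0 i p x : 0 <= (2 ^ p)%:R ^- 2 * dev i p x ^+ 2.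
  by rewrite mulr_ge0 ?sqr_ge0 // invr_ge0 exprn_ge0 // ltW.
pose c := \sum_i (rho i - rho i ^+ 2).
have intf p : (\int[P]_x (f p x)%:E = (c * 2^-1 ^+ p)%:E)%E.
  under eq_integral do rewrite /f -sumEFin.
  rewrite ge0_integral_sum //; last 2 first.
  - by move=> i; apply/measurable_EFinP.
  - by move=> i x _; rewrite lee_fin.
  rewrite (eq_bigr (fun i => ((rho i - rho i ^+ 2) * 2^-1 ^+ p)%:E)); last first.
    move=> i _; under eq_integral do rewrite EFinM.
    rewrite ge0_integralZl_EFin //; last 2 first.
    - by move=> x _; rewrite lee_fin sqr_ge0.
    - by apply/measurable_EFinP; exact: measurable_funX.
    have rhoE : (2 ^ p)%:R ^- 2 * ((2 ^ p)%:R * (rho i - rho i ^+ 2)) =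
        (rho i - rho i ^+ 2) * 2^-1 ^+ p.
      by move: (n0 p); rewrite exprVn natrX => N0; field; exact: lt0r_neq0.
    by rewrite (variance_occurrences (mA i) (PA i) (@PAI i)) -EFinM rhoE.
  by rewrite sumEFin -mulr_suml.
have intf0 : (fun p => \int[P]_x (f p x)%:E)%E @ \oo --> 0%E.
  rewrite (funext intf); apply: cvg_EFin; first exact: nearW.
  rewrite -[X in _ --> X](mulr0 c); apply: cvgM; first exact: cvg_cst.
  by apply: cvg_expr; rewrite ger0_norm ?invr_ge0 // invf_lt1 // ltr1n.
have mf p : measurable_fun setT (f p) by exact: measurable_sum.
have f0 p x : 0 <= f p x by exact: sumr_ge0.
have := ae_small_infinitely_often mf f0 intf0; apply: filterS => x small e e0 p0.
have [p p0p fpe] := small (e ^+ 2) (exprn_gt0 2 e0) p0; exists p => // i.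
rewrite -ler_sqr ?nnegrE ?(ltW e0) // real_normK ?num_real //.
have -> : ((\sum_(q < 2 ^ p) \1_(A i q) x) / (2 ^ p)%:R - rho i) ^+ 2 =
    (2 ^ p)%:R ^- 2 * dev i p x ^+ 2.
  move: (n0 p); rewrite /dev; move: (2 ^ p)%:R => N N0; field.
  exact: lt0r_neq0.
by apply: le_trans fpe; rewrite /f (bigD1 i) //= lerDl sumr_ge0.
Qed.

Section BernoulliShift.
Context (R : realType) (k : nat).
Variables (m : probability (labels k) R) (P : probability (bisequences k) R).
Hypothesis P_power : is_power_measure m P.

Lemma ae_visit_frequencies :
  {ae P, forall w, forall e, 0 < e -> forall p0, exists2 p, (p0 <= p)%N &
    forall i, `|(visits (2 ^ p) w i)%:R / (2 ^ p)%:R -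
                fine (m [set (i : labels k)])| <= e}.
Proof.
pose A (i : labels k) (p : nat) : set (bisequences k) := [set w | w p%:Z = i].
have mi i : m [set i] = (fine (m [set i]))%:E by rewrite fineK // fin_num_measure.
have mA i p : measurable (A i p).
  by apply: sub_sigma_algebra; exists p%:Z, [set i].
have PA i p : P (A i p) = (fine (m [set i]))%:E.
  have := P_power (fun=> [set i]) (isT : uniq [:: p%:Z]).
  rewrite big_seq1 -mi => <-; congr (P _); apply/seteqP; split => w /=.
    by move=> wp n; rewrite inE => /eqP ->.
  by apply; rewrite inE.
have PAI i p q : p != q ->
    P (A i p `&` A i q) = (fine (m [set i]) * fine (m [set i]))%:E.
  move=> pq; have u : uniq [:: p%:Z; q%:Z] by rewrite /= inE andbT.
  have := P_power (fun=> [set i]) u.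
  rewrite big_cons big_seq1 EFinM -mi => <-; congr (P _).
  apply/seteqP; split => w /=.
    by move=> [wp wq] n; rewrite !inE => /orP[] /eqP ->.
  by move=> H; split; apply: H; rewrite !inE eqxx ?orbT.
have := ae_frequencies mA PA PAI.
apply: filterS => w freq e e0 p0.
have [p p0p Hp] := freq e e0 p0; exists p => // i.
rewrite (_ : (visits _ _ _)%:R = \sum_(q < 2 ^ p) \1_(A i q) w) //.
rewrite natr_sum; apply: eq_bigr => q _; rewrite indicE.
suff -> : (w \in A i q) = (w q%:Z == i) by [].
by apply/idP/eqP => [/set_mem|wq]; last exact/mem_set.
Qed.

End BernoulliShift.

Theorem theorem2p1 (R : realType) (M : ptopologicalType) (d k : nat)
  (X : closed_manifold R M d) (g : riemannian_metric X)
  (T : C1_action X k.+1)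
  (mu : probability (borel M) R) (mu_inv : action_invariant T mu)
  (m : probability (labels k) R)
  (P : probability (bisequences k) R) (P_power : is_power_measure m P)
  (spec : lyapunov_spectrum g T mu) (L : random_exponents P spec) :
  {ae (P \x mu)%E, forall z, random_regular L z /\
    forall j, (j < nblocks spec z.2)%N ->
      random_exponent L j z =
      \sum_(i < k.+1) fine (m [set (i : labels k)]) * exponent spec i j z.2}.
Proof.
have ae_regular : {ae (P \x mu)%E, forall z, random_regular L z}.
  have mL := random_regular_measurable L.
  exists (~` random_regular L); split => //; first exact: measurableC.
  rewrite probability_setC // -(@subee _ 1%E) //; congr (_ - _)%E.
  exact: random_regular_full L.
have [N [mN PN0 freqN]] := ae_visit_frequencies P_power.
have ae_freq : {ae (P \x mu)%E, forall z : bisequences k * borel M, ~ N z.1}.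
  exists (N `*` setT); split.
  - exact: measurableX.
  - apply: etrans (product_measure1E P mu mN measurableT) _.
    by rewrite [X in (X * _)%E](PN0 : P N = 0%E) mul0e.
  - by move=> [w x] /= /contrapT Nw; split.
apply: filterS2 ae_regular ae_freq => -[w x] Lwx /= Nw; split => // j jx.
apply: random_exponent_eq Lwx jx _.
by apply: contrapT => nfreq; apply: Nw; exact: freqN.
Qed.
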